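(* Let $m\in\{1,2,\dots\}$ and let $0<p<\frac12$. Then the equilibrium point $\bar y=\frac{1+\sqrt{1+4p}}{2}$ of the difference equation $$y_{n+1}=1+p\,\frac{y_{n-m}}{y_n^{2}},\qquad n=0,1,2,\dots,$$ is globally asymptotically stable.
   Context: Solutions are sequences $\{y_n\}_{n=-m}^{\infty}$ of positive real numbers with arbitrary positive initial values $y_{-m},\dots,y_0$. The equilibrium $\bar y$ is locally stable if for every $\varepsilon>0$ there is $\delta>0$ such that every solution with $\sum_{i=0}^{m}|y_{-i}-\bar y|<\delta$ satisfies $|y_n-\bar y|<\varepsilon$ for all $n\ge -m$. It is globally asymptotically stable if it is locally stable and every (positive) solution satisfies $\lim_{n\to\infty}y_n=\bar y$. *)

(* Defs.v *)
(* Stdlib reals, with Coquelicot limits. *)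
From Stdlib Require Import Reals.
From Coquelicot Require Import Coquelicot.
Open Scope R_scope.

(** A sequence [{y_n}] with [n >= -m] is encoded, shifting indices by [m], as
    [y : nat -> R], where [y k] stands for [y_{k-m}]. Thus the initial values
    [y_{-m}, ..., y_0] are [y 0, ..., y m], while [y_{n-m}], [y_n] and
    [y_{n+1}] are [y n], [y (n + m)] and [y (n + 1 + m)]. *)

(** Positive solutions of [y_{n+1} = F y_n y_{n-m}]. *)
Definition solution (m : nat) (F : R -> R -> R) (y : nat -> R) : Prop :=
  (forall k : nat, 0 < y k) /\
  (forall n : nat, y (n + 1 + m)%nat = F (y (n + m)%nat) (y n)).

Definition equilibrium (F : R -> R -> R) (ybar : R) : Prop :=
  ybar = F ybar ybar.

(** For [i <= m], the initial value [y_{-i}] is [y (m - i)]. *)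
Definition locally_stable (m : nat) (F : R -> R -> R) (ybar : R) : Prop :=
  forall eps : R, 0 < eps ->
  exists delta : R, 0 < delta /\
    forall y : nat -> R, solution m F y ->
      sum_f_R0 (fun i : nat => Rabs (y (m - i)%nat - ybar)) m < delta ->
      forall k : nat, Rabs (y k - ybar) < eps.

Definition globally_asymptotically_stable
    (m : nat) (F : R -> R -> R) (ybar : R) : Prop :=
  locally_stable m F ybar /\
  forall y : nat -> R, solution m F y -> is_lim_seq y (Finite ybar).

(* Main.v *)
Require Import Defs.
From Stdlib Require Import Reals Lra Lia.
From Coquelicot Require Import Coquelicot.
Open Scope R_scope.

(** Why the theorem is true.  The map [F u v = 1 + p v / u^2] decreases in [u]
    and increases in [v].  Every positive solution is at least [1] after its
    initial values, hence bounded, because [F u v <= 1 + p v] when [1 <= u], and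
    [p < 1].  Its lower and upper limits [I] and [S] are therefore finite, with
    [1 <= I], and passing to the limit along extremal subsequences, monotonicity
    gives [S <= F I S] and [F S I <= I] ([limsup_le_map], [map_le_liminf]).
    Multiplying the first inequality by [I^2 S] and the second by [S^2 I]
    makes the terms [S^2 I^2] comparable, and what remains is
    [S I (S - I) <= p (S - I) (S + I)].  If [I < S], this says
    [1 <= p (1/I + 1/S) <= 2 p], contrary to [p < 1/2]
    ([mixed_inequalities_collapse]).  So [I = S], and this common value is a
    positive fixed point of [F], hence the equilibrium.

    Local stability comes from the linearization: at the equilibrium [b] the
    partial derivatives of [F] have absolute values [2p/b^2] and [p/b^2], whose
    sum [3p/b^2] is less than [1] because [b^2 = b + p] and [2p < 1 < b].  So
    [F] maps every small square centred at [(b, b)] into the corresponding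
    interval centred at [b] ([map_preserves_small_balls]), and a solution that
    starts in such an interval never leaves it. *)

(** * Sums and limits of bounded sequences *)

Lemma term_le_sum (a : nat -> R) (N i : nat) :
  (forall k, 0 <= a k) -> (i <= N)%nat -> a i <= sum_f_R0 a N.
Proof.
  intros Ha. induction N as [|N IH]; intros Hi.
  - replace i with 0%nat by lia. apply Rle_refl.
  - pose proof (cond_pos_sum a N Ha). pose proof (Ha (S N)). cbn.
    destruct (PeanoNat.Nat.eq_dec i (S N)) as [->|Hne]; [lra|].
    specialize (IH ltac:(lia)). lra.
Qed.

Lemma bounded_LimInf_LimSup (y : nat -> R) (a B : R) :
  eventually (fun n => a <= y n) -> (forall n, y n <= B) ->
  exists I S, is_LimInf_seq y (Finite I) /\ is_LimSup_seq y (Finite S) /\ a <= I <= S.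
Proof.
  intros Ha HB.
  destruct (ex_LimInf_seq y) as [I HI]. destruct (ex_LimSup_seq y) as [S HS].
  assert (H1 : Rbar_le a I).
  { rewrite <- (is_LimInf_seq_unique _ _ (is_LimInf_seq_const a)),
      <- (is_LimInf_seq_unique _ _ HI). now apply LimInf_le. }
  assert (H2 : Rbar_le I S) by exact (is_LimSup_LimInf_seq_le _ _ _ HS HI).
  assert (H3 : Rbar_le S B).
  { rewrite <- (is_LimSup_seq_unique _ _ (is_LimSup_seq_const B)),
      <- (is_LimSup_seq_unique _ _ HS). apply LimSup_le. now exists 0%nat. }
  destruct I as [I| |], S as [S| |]; cbn in *; try easy.
  now exists I, S.
Qed.

(** * Monotone delay equations *)

Section MonotoneDelay.

Context {m : nat} {F : R -> R -> R} {y : nat -> R}.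
Hypothesis sol : solution m F y.

Lemma solution_recursion (k : nat) :
  (m < k)%nat -> exists n, k = (n + 1 + m)%nat /\ y k = F (y (n + m)%nat) (y n).
Proof.
  intros Hk. exists (k - 1 - m)%nat.
  assert (E : k = (k - 1 - m + 1 + m)%nat) by lia.
  split; [exact E|]. rewrite E at 1. apply (proj2 sol).
Qed.

Hypothesis mono : forall u u' v v' : R,
  0 < u' <= u -> 0 < v <= v' -> F u v <= F u' v'.

Variables I S : R.
Hypothesis I_pos : 0 < I.
Hypothesis liminf_y : is_LimInf_seq y (Finite I).
Hypothesis limsup_y : is_LimSup_seq y (Finite S).

(** Late terms close to [S] are values of [F] at terms that exceed [I - e] and
    terms below [S + e]; monotonicity bounds them by [F (I - e) (S + e)],
    which is close to [F I S] by continuity. *)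
Lemma limsup_le_map : continuity_2d_pt F I S -> S <= F I S.
Proof.
  intros cont. destruct (Rle_or_lt S (F I S)) as [H|H]; [exact H|exfalso].
  assert (Hh : 0 < (S - F I S) / 2) by lra.
  destruct (cont (mkposreal _ Hh)) as [d Hd]; cbn in Hd.
  pose proof (cond_pos d) as Hd0.
  assert (He : 0 < Rmin (d / 2) (I / 2)) by (apply Rmin_glb_lt; lra).
  pose proof (Rmin_l (d / 2) (I / 2)). pose proof (Rmin_r (d / 2) (I / 2)).
  set (e := Rmin (d / 2) (I / 2)) in *.
  destruct (proj2 (liminf_y (mkposreal _ He))) as [N1 HN1].
  destruct (proj2 (limsup_y (mkposreal _ He))) as [N2 HN2].
  destruct (proj1 (limsup_y (mkposreal _ Hh)) (N1 + N2 + m + 1)%nat)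
    as [k [Hk Hyk]].
  cbn in *.
  destruct (solution_recursion k) as [n [-> Hrec]]; [lia|].
  assert (A1 : I - e < y (n + m)%nat) by (apply HN1; lia).
  assert (A2 : y n < S + e) by (apply HN2; lia).
  assert (A3 : F (y (n + m)%nat) (y n) <= F (I - e) (S + e)).
  { apply mono; split; try lra. apply (proj1 sol). }
  assert (A4 := Hd (I - e) (S + e)).
  replace (I - e - I) with (- e) in A4 by ring.
  replace (S + e - S) with e in A4 by ring.
  rewrite Rabs_Ropp, (Rabs_pos_eq e) in A4 by lra.
  specialize (A4 ltac:(lra) ltac:(lra)).
  apply Rabs_def2 in A4. lra.
Qed.

(** The mirror image: late terms close to [I] are at least
    [F (S + e) (I - e)].  Here [e < I] matters, since [F] is monotone only on
    positive arguments. *)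
Lemma map_le_liminf : continuity_2d_pt F S I -> F S I <= I.
Proof.
  intros cont. destruct (Rle_or_lt (F S I) I) as [H|H]; [exact H|exfalso].
  assert (Hh : 0 < (F S I - I) / 2) by lra.
  destruct (cont (mkposreal _ Hh)) as [d Hd]; cbn in Hd.
  pose proof (cond_pos d) as Hd0.
  assert (He : 0 < Rmin (d / 2) (I / 2)) by (apply Rmin_glb_lt; lra).
  pose proof (Rmin_l (d / 2) (I / 2)). pose proof (Rmin_r (d / 2) (I / 2)).
  set (e := Rmin (d / 2) (I / 2)) in *.
  destruct (proj2 (liminf_y (mkposreal _ He))) as [N1 HN1].
  destruct (proj2 (limsup_y (mkposreal _ He))) as [N2 HN2].
  destruct (proj1 (liminf_y (mkposreal _ Hh)) (N1 + N2 + m + 1)%nat)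
    as [k [Hk Hyk]].
  cbn in *.
  destruct (solution_recursion k) as [n [-> Hrec]]; [lia|].
  assert (A1 : y (n + m)%nat < S + e) by (apply HN2; lia).
  assert (A2 : I - e < y n) by (apply HN1; lia).
  assert (A3 : F (S + e) (I - e) <= F (y (n + m)%nat) (y n)).
  { apply mono; split; try lra. apply (proj1 sol). }
  assert (A4 := Hd (S + e) (I - e)).
  replace (I - e - I) with (- e) in A4 by ring.
  replace (S + e - S) with e in A4 by ring.
  rewrite Rabs_Ropp, (Rabs_pos_eq e) in A4 by lra.
  specialize (A4 ltac:(lra) ltac:(lra)).
  apply Rabs_def2 in A4. lra.
Qed.

End MonotoneDelay.

(** Induction along the recursion keeps a solution in the interval of radius
    [d] that contains its initial values.  The choice [d = min (eps, e0)] also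
    serves as [delta], because each initial deviation is at most their sum. *)
Lemma locally_stable_of_preserved_balls (m : nat) (F : R -> R -> R) (b e0 : R) :
  0 < e0 ->
  (forall d u v : R, 0 < d <= e0 ->
     Rabs (u - b) < d -> Rabs (v - b) < d -> Rabs (F u v - b) < d) ->
  locally_stable m F b.
Proof.
  intros He0 HF eps Heps.
  assert (Hd : 0 < Rmin eps e0) by (apply Rmin_glb_lt; lra).
  pose proof (Rmin_l eps e0). pose proof (Rmin_r eps e0).
  set (d := Rmin eps e0) in *.
  exists d; split; [exact Hd|]. intros y sol Hsum k.
  apply Rlt_le_trans with d; [|lra].
  induction k as [k IH] using (well_founded_induction Wf_nat.lt_wf).
  destruct (Compare_dec.le_lt_dec k m) as [Hk|Hk].
  - apply Rle_lt_trans with (2 := Hsum).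
    replace k with (m - (m - k))%nat at 1 by lia.
    generalize (m - k)%nat (PeanoNat.Nat.le_sub_l m k). intros i Hi.
    apply (term_le_sum (fun i => Rabs (y (m - i)%nat - b))); [|exact Hi].
    intros; apply Rabs_pos.
  - destruct (solution_recursion sol k Hk) as [n [-> ->]].
    apply HF; [lra|apply IH; lia|apply IH; lia].
Qed.

(** * The map [1 + p v / u^2] *)

Definition delay_map (p u v : R) : R := 1 + p * (v / u ^ 2).

Lemma delay_map_monotone (p u u' v v' : R) :
  0 <= p -> 0 < u' <= u -> 0 < v <= v' -> delay_map p u v <= delay_map p u' v'.
Proof.
  intros Hp Hu Hv. unfold delay_map, Rdiv.
  apply Rplus_le_compat_l, Rmult_le_compat_l; [exact Hp|].
  assert (0 < u' ^ 2) by (apply pow_lt; lra).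
  assert (u' ^ 2 <= u ^ 2) by (apply pow_incr; lra).
  apply Rmult_le_compat; try lra.
  - left; apply Rinv_0_lt_compat; lra.
  - apply Rinv_le_contravar; lra.
Qed.

Lemma delay_map_continuous (p u v : R) :
  0 < u -> continuity_2d_pt (delay_map p) u v.
Proof.
  intros Hu. unfold delay_map, Rdiv.
  apply continuity_2d_pt_plus; [apply continuity_2d_pt_const|].
  apply continuity_2d_pt_mult; [apply continuity_2d_pt_const|].
  apply continuity_2d_pt_mult; [apply continuity_2d_pt_id2|].
  apply continuity_2d_pt_inv; [|apply pow_nonzero; lra].
  apply continuity_2d_pt_ext with (fun x _ => x * x); [intros; ring|].
  apply continuity_2d_pt_mult; apply continuity_2d_pt_id1.
Qed.

Lemma solution_ge_1 (m : nat) (p : R) (y : nat -> R) :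
  0 <= p -> solution m (delay_map p) y -> forall k, (m < k)%nat -> 1 <= y k.
Proof.
  intros Hp sol k Hk.
  destruct (solution_recursion sol k Hk) as [n [-> ->]]. unfold delay_map.
  pose proof (proj1 sol n). pose proof (pow_lt _ 2 (proj1 sol (n + m)%nat)).
  assert (0 <= y n / y (n + m)%nat ^ 2) by (apply Rlt_le, Rdiv_lt_0_compat; lra).
  nra.
Qed.

Lemma solution_bounded (m : nat) (p : R) (y : nat -> R) :
  0 < p < 1 / 2 -> solution m (delay_map p) y -> exists B, forall k, y k <= B.
Proof.
  intros Hp sol. pose proof (proj1 sol) as Hpos.
  (* The recursion reads [y_{n+1} <= 1 + p y_{n-m}] only once [y_n >= 1], so the
     first computed term counts as initial here.  Any [B >= 2] then satisfies
     [1 + p B <= B]. *)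
  exists (2 + sum_f_R0 y (S m)).
  assert (Hs : 0 <= sum_f_R0 y (S m)).
  { apply cond_pos_sum. intros; left; apply Hpos. }
  intros k. induction k as [k IH] using (well_founded_induction Wf_nat.lt_wf).
  destruct (Compare_dec.le_lt_dec k (S m)) as [Hk|Hk].
  - pose proof (term_le_sum y (S m) k (fun i => Rlt_le _ _ (Hpos i)) Hk). lra.
  - destruct (solution_recursion sol k) as [n [-> ->]]; [lia|].
    assert (H1 : 1 <= y (n + m)%nat) by (apply (solution_ge_1 m p); auto; lra || lia).
    assert (H2 : y n <= 2 + sum_f_R0 y (S m)) by (apply IH; lia).
    apply Rle_trans with (delay_map p 1 (2 + sum_f_R0 y (S m))).
    + apply delay_map_monotone; pose proof (Hpos n); lra.
    + unfold delay_map. rewrite pow1, Rdiv_1_r. nra.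
Qed.

(** Equality in both hypotheses would be the system [S = F I S], [I = F S I].
    Already the inequalities exclude [I < S]: after clearing denominators and
    subtracting, the factor [S - I] splits off, and the cofactor
    [S I - p (S + I)] is positive. *)
Lemma mixed_inequalities_collapse (p I S : R) :
  p < 1 / 2 -> 1 <= I <= S ->
  S <= delay_map p I S -> delay_map p S I <= I -> I = S.
Proof.
  intros Hp HIS HS HI. unfold delay_map in *.
  assert (E1 : S * I ^ 2 <= I ^ 2 + p * S).
  { replace (I ^ 2 + p * S) with ((1 + p * (S / I ^ 2)) * I ^ 2) by (field; lra).
    apply Rmult_le_compat_r; [apply pow2_ge_0|exact HS]. }
  assert (E2 : S ^ 2 + p * I <= I * S ^ 2).
  { replace (S ^ 2 + p * I) with ((1 + p * (I / S ^ 2)) * S ^ 2) by (field; lra).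
    apply Rmult_le_compat_r; [apply pow2_ge_0|exact HI]. }
  apply (Rmult_le_compat_l S) in E1; [|lra].
  apply (Rmult_le_compat_l I) in E2; [|lra].
  assert (E3 : (S - I) * (S * I - p * (S + I)) <= 0) by nra.
  (* [S + I <= 2 S I] since both are at least [1]. *)
  assert (E4 : 0 < S * I - p * (S + I)) by nra.
  nra.
Qed.

(** * The equilibrium *)

Section Equilibrium.

Variables (p b : R).
Hypothesis p_bounds : 0 < p < 1 / 2.
Hypothesis b_gt_1 : 1 < b.
(** The fixed point equation of [delay_map p] on positive numbers. *)
Hypothesis b_root : b ^ 2 = b + p.

Lemma fixed_point_unique (x : R) : 0 < x -> x = delay_map p x x -> x = b.
Proof.
  intros Hx E. unfold delay_map in E.
  assert (E' : x ^ 2 = x + p).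
  { replace (x + p) with (x * (1 + p * (x / x ^ 2))) by (field; lra).
    rewrite <- E. ring. }
  assert ((x - b) * (x + b - 1) = 0) as H by nra.
  apply Rmult_integral in H. lra.
Qed.

(** The deviation of the map is
    [F u v - b = p (b (v - b) - (u - b) (u + b)) / (u^2 b)], so it is less than
    [d] as soon as [p (3 b + d) <= (b - d)^2 b].  Dropping [d^2] from the square
    and using [b^2 - 3 p = b - 2 p], this follows from
    [d (2 b^2 + p) <= b (b - 2 p)]. *)
Lemma map_preserves_small_balls (d u v : R) :
  0 < d <= b * (b - 2 * p) / (2 * b ^ 2 + p) ->
  Rabs (u - b) < d -> Rabs (v - b) < d -> Rabs (delay_map p u v - b) < d.
Proof.
  intros [Hd Hd'] Hu Hv.
  assert (D : d * (2 * b ^ 2 + p) <= b * (b - 2 * p)).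
  { replace (b * (b - 2 * p))
      with (b * (b - 2 * p) / (2 * b ^ 2 + p) * (2 * b ^ 2 + p)) by (field; nra).
    apply Rmult_le_compat_r; nra. }
  assert (Hdb : d < b) by nra.
  apply Rabs_def2 in Hu. apply Rabs_def2 in Hv.
  assert (Hu0 : 0 < u) by lra.
  assert (Hden : 0 < u ^ 2 * b) by (apply Rmult_lt_0_compat; [apply pow_lt|]; lra).
  replace (delay_map p u v - b)
    with (p * (b * (v - b) - (u - b) * (u + b)) / (u ^ 2 * b)).
  2:{ unfold delay_map.
      replace (1 + p * (v / u ^ 2) - b)
        with (p * (v / u ^ 2) - (b ^ 2 - b) / b) by (field; lra).
      replace (b ^ 2 - b) with p by lra. field. lra. }
  assert (Hsq : (b - d) ^ 2 <= u ^ 2) by (apply pow_incr; lra).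
  assert (K : p * (3 * b + d) <= u ^ 2 * b).
  { apply Rle_trans with ((b - d) ^ 2 * b).
    - replace ((b - d) ^ 2 * b)
        with (b ^ 2 * b - 2 * d * b ^ 2 + d ^ 2 * b) by ring.
      assert (0 <= d ^ 2 * b) by (apply Rmult_le_pos; [apply pow2_ge_0|lra]).
      rewrite b_root in *. nra.
    - apply Rmult_le_compat_r; lra. }
  assert (U : - (d * (2 * b + d)) < (u - b) * (u + b) < d * (2 * b + d)) by nra.
  assert (V : - (b * d) < b * (v - b) < b * d) by nra.
  assert (K' : d * (p * (3 * b + d)) <= d * (u ^ 2 * b))
    by (apply Rmult_le_compat_l; lra).
  apply Rabs_def1.
  - apply Rmult_lt_reg_r with (u ^ 2 * b); [exact Hden|].
    unfold Rdiv. rewrite Rmult_assoc, Rinv_l, Rmult_1_r by lra. nra.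
  - apply Rmult_lt_reg_r with (u ^ 2 * b); [exact Hden|].
    unfold Rdiv. rewrite Rmult_assoc, Rinv_l, Rmult_1_r by lra. nra.
Qed.

Lemma equilibrium_locally_stable (m : nat) : locally_stable m (delay_map p) b.
Proof.
  apply locally_stable_of_preserved_balls
    with (e0 := b * (b - 2 * p) / (2 * b ^ 2 + p)).
  - apply Rdiv_lt_0_compat; nra.
  - exact map_preserves_small_balls.
Qed.

Lemma equilibrium_attractive (m : nat) (y : nat -> R) :
  solution m (delay_map p) y -> is_lim_seq y (Finite b).
Proof.
  intros sol.
  destruct (solution_bounded m p y p_bounds sol) as [B HB].
  assert (H1 : forall k, (m < k)%nat -> 1 <= y k)
    by (apply (solution_ge_1 m p); auto; lra).
  assert (mono : forall u u' v v', 0 < u' <= u -> 0 < v <= v' ->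
    delay_map p u v <= delay_map p u' v')
    by (intros; apply delay_map_monotone; auto; lra).
  destruct (bounded_LimInf_LimSup y 1 B) as (I & S & HI & HS & HIS).
  - exists (m + 1)%nat. intros k Hk. apply H1. lia.
  - exact HB.
  - assert (cont : forall u v, 1 <= u -> continuity_2d_pt (delay_map p) u v)
      by (intros; apply delay_map_continuous; lra).
    assert (I_pos : 0 < I) by lra.
    assert (ES := limsup_le_map sol mono I S I_pos HI HS (cont I S ltac:(lra))).
    assert (EI := map_le_liminf sol mono I S I_pos HI HS (cont S I ltac:(lra))).
    assert (E : I = S) by (apply (mixed_inequalities_collapse p); auto; lra).
    subst S.
    assert (Eb : I = b) by (apply fixed_point_unique; lra).
    subst I. now apply is_LimSup_LimInf_lim_seq.
Qed.

End Equilibrium.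

Theorem theorem11 (m : nat) (p : R) (hm : (1 <= m)%nat) (hp : 0 < p < 1 / 2) :
  let F := fun u v : R => 1 + p * (v / u ^ 2) in
  let ybar := (1 + sqrt (1 + 4 * p)) / 2 in
  equilibrium F ybar /\ globally_asymptotically_stable m F ybar.
Proof.
  intros F ybar.
  assert (Hs : sqrt (1 + 4 * p) ^ 2 = 1 + 4 * p) by (apply pow2_sqrt; lra).
  assert (Hgt : 1 < ybar).
  { unfold ybar. pose proof (sqrt_pos (1 + 4 * p)). nra. }
  assert (Hroot : ybar ^ 2 = ybar + p) by (unfold ybar; nra).
  split; [|split].
  - unfold equilibrium, F.
    replace (1 + p * (ybar / ybar ^ 2)) with ((ybar + p) / ybar) by (field; lra).
    rewrite <- Hroot. field. lra.
  - exact (equilibrium_locally_stable p ybar hp Hgt Hroot m).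
  - exact (equilibrium_attractive p ybar hp Hgt Hroot m).
Qed.
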